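(* For all integers $r\ge1$ and $m\ge2$, the vector $$\bigl(F^{(m)}_{r,1}(t),F^{(m)}_{r,2}(t),\dots,F^{(m)}_{r,m}(t)\bigr),\qquad F^{(m)}_{r,j}(t)=\sum_{\substack{\mathbf w\in \mathrm{Smir}_{r,m}\\ w_r=m+1-j}}t^{\mathrm{des}(\mathbf w)},$$ is an interlacing sequence. Consequently, the polynomial $$\sum_{\mathbf w\in \mathrm{Smir}_{r,m}}t^{\mathrm{des}(\mathbf w)}$$ is real-rooted.
   Context: A Smirnov word is a word with no two equal adjacent letters; $\mathrm{Smir}_{r,m}$ is the set of Smirnov words $\mathbf w=w_1\cdots w_r$ of length $r$ on the alphabet $[m]=\{1,\dots,m\}$. $\mathrm{des}(\mathbf w)$ is the number of $1\le i<r$ with $w_i>w_{i+1}$. A polynomial is real-rooted if all its complex zeros are real (positive constants are real-rooted with empty zero set). For real-rooted polynomials $f,g$ with positive leading coefficients, list the zeros with multiplicity as $\alpha_1\ge\dots\ge\alpha_r$ (of $f$) and $\beta_1\ge\dots\ge\beta_s$ (of $g$). Write $f\ll g$ if $s\in\{r,r+1\}$ and $$\beta_{r+1}\le\alpha_r\le\beta_r\le\dots\le\alpha_1\le\beta_1,$$ where the leftmost term is omitted when $s=r$; for $r=0$ only the degree condition $s\in\{0,1\}$ remains. An interlacing sequence is a sequence $(f_1,\dots,f_m)$ such that $f_i\ll f_j$ whenever $i<j$. *)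

(* Defs.v *)
From mathcomp Require Import all_boot all_order all_algebra.
From mathcomp Require Import reals complex.
Set Implicit Arguments.
Unset Strict Implicit.
Unset Printing Implicit Defensive.
Import Order.TTheory GRing.Theory Num.Theory.
Local Open Scope ring_scope.

Section Words.
Local Open Scope nat_scope.

(* An ordinal a : 'I_m encodes the letter a + 1 of the alphabet {1, ..., m}. *)
Definition letters (m r : nat) (w : r.-tuple 'I_m) : seq nat :=
  [seq (val a).+1 | a <- w].

Definition smirnov (w : seq nat) : bool :=
  sorted (fun a b : nat => a != b) w.

(* The index i counts from 0: it compares the (i+1)-st and (i+2)-nd letters. *)
Definition des (w : seq nat) : nat :=
  #|[set i : 'I_(size w).-1 | nth 0 w i > nth 0 w i.+1]|.

End Words.

Definition Smir (r m : nat) : {set r.-tuple 'I_m} :=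
  [set w | smirnov (letters w)].

(* The index j ranges over 1, ..., m. The default value of [last] is only used
   for r = 0. *)
Definition smirnovF (R : realType) (m r j : nat) : {poly R} :=
  \sum_(w in Smir r m | last 0%N (letters w) == (m + 1 - j)%N)
    'X^(des (letters w)).

Definition real_rooted (R : realType) (p : {poly R}) : Prop :=
  forall z : R[i], root (map_poly (real_complex R) p) z -> complex.Im z = 0.

(* The real zeros in decreasing order, repeated according to multiplicity; when
   p is real-rooted and nonzero these are all its complex zeros. *)
Definition zeros_list (R : realType) (p : {poly R}) (s : seq R) : Prop :=
  sorted (fun x y : R => x >= y) s /\
  forall x : R, count_mem x s = mup x p.

Definition interlaces (R : realType) (f g : {poly R}) : Prop :=
  [/\ real_rooted f, real_rooted g, 0 < lead_coef f, 0 < lead_coef g &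
   exists alpha beta : seq R,
     [/\ zeros_list f alpha,
         zeros_list g beta,
         size beta = size alpha \/ size beta = (size alpha).+1,
         forall i, (i < size alpha)%N -> alpha`_i <= beta`_i &
         forall i, (i < size alpha)%N -> (i.+1 < size beta)%N ->
           beta`_i.+1 <= alpha`_i]].

Definition interlacing_seq (R : realType) (m : nat) (f : 'I_m -> {poly R}) :
    Prop :=
  forall i j : 'I_m, (i < j)%N -> interlaces (f i) (f j).

(* Main.v *)
Require Import Defs.
From mathcomp Require Import all_boot all_order all_algebra.
From mathcomp Require Import reals complex polyrcf ring lra zify.
Local Open Scope ring_scope.

(* For z in the upper half plane write <u, v> = Im (v * conj u). For real-rooted
   f, g with positive leading coefficients, f << g follows from
   <f(z), g(z)> >= 0 for all such z, and this condition is bilinear in (f, g).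
   Deleting the last letter of a word gives
   F_{r+1,j} = t * sum_{i<j} F_{r,i} + sum_{i>j} F_{r,i}. The conditions
   <F_i, F_j> >= 0 and <F_j, z F_i> >= 0 for i <= j say that at each z the values
   F_1, ..., F_m, z F_1 have increasing arguments; they are preserved by the
   recurrence, and they force the F_j and their sum not to vanish at z, whence
   real-rootedness.
   To read off the interlacing, let D(x) be the number of zeros of g above x
   minus that of f. Near a real zero c of f g, g/f behaves like K (z - c)^d with
   K of sign (-1)^D(c); mapping the upper half plane to its closure forces d = 0,
   or d = 1 and K > 0, or d = -1 and K < 0. As D = 0 near +oo, moving down the
   real line keeps D in {0, 1}. *)

Set Implicit Arguments.
Unset Strict Implicit.
Unset Printing Implicit Defensive.
Import Order.TTheory GRing.Theory Num.Theory.
Local Open Scope complex_scope.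

(** * Complex numbers in a sector *)

Definition cross (R : pzRingType) (u v : R[i]) : R :=
  complex.Re u * complex.Im v - complex.Im u * complex.Re v.

Section Cross.
Variable R : rcfType.
Implicit Types (u v z : R[i]) (I : finType).

Lemma crossDl u1 u2 v : cross (u1 + u2) v = cross u1 v + cross u2 v.
Proof. by case: u1 u2 v => a b [c d] [e f]; rewrite /cross /=; ring. Qed.

Lemma crossDr u v1 v2 : cross u (v1 + v2) = cross u v1 + cross u v2.
Proof. by case: u v1 v2 => a b [c d] [e f]; rewrite /cross /=; ring. Qed.

Lemma cross0l v : cross 0 v = 0.
Proof. by rewrite /cross /= !mul0r subrr. Qed.

Lemma cross0r u : cross u 0 = 0.
Proof. by rewrite /cross /= !mulr0 subrr. Qed.

Lemma crossvv u : cross u u = 0.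
Proof. by rewrite /cross mulrC subrr. Qed.

Lemma crossNr u v : cross u (- v) = - cross u v.
Proof. by case: u v => a b [c d]; rewrite /cross /=; ring. Qed.

Lemma cross_suml_ge0 I (P : pred I) (F : I -> R[i]) v :
  (forall i, P i -> 0 <= cross (F i) v) -> 0 <= cross (\sum_(i | P i) F i) v.
Proof.
move=> Fv; elim/big_rec: _ => [|i u Pi IHu]; first by rewrite cross0l.
by rewrite crossDl addr_ge0 ?Fv.
Qed.

Lemma cross_sumr_ge0 I (P : pred I) (F : I -> R[i]) u :
  (forall i, P i -> 0 <= cross u (F i)) -> 0 <= cross u (\sum_(i | P i) F i).
Proof.
move=> uF; elim/big_rec: _ => [|i v Pi IHv]; first by rewrite cross0r.
by rewrite crossDr addr_ge0 ?uF.
Qed.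

Lemma crossM z u v :
  cross (z * u) (z * v) = (complex.Re z ^+ 2 + complex.Im z ^+ 2) * cross u v.
Proof. by case: z u v => a b [c d] [e f]; rewrite /cross /=; ring. Qed.

Lemma cross_mulz u z :
  cross u (z * u) = complex.Im z * (complex.Re u ^+ 2 + complex.Im u ^+ 2).
Proof. by case: z u => a b [c d]; rewrite /cross /=; ring. Qed.

Lemma cross_mulz_ge0 u z : 0 <= complex.Im z -> 0 <= cross u (z * u).
Proof. by move=> z0; rewrite cross_mulz mulr_ge0 ?addr_ge0 ?sqr_ge0. Qed.

Lemma cross_mulz_gt0 u z : 0 < complex.Im z -> u != 0 -> 0 < cross u (z * u).
Proof.
move=> z0 u0; rewrite cross_mulz mulr_gt0 // lt_def addr_ge0 ?sqr_ge0 //.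
rewrite andbT paddr_eq0 ?sqr_ge0 // !sqrf_eq0; apply: contra u0.
by rewrite eq_complex.
Qed.

Lemma cross_anti u v : cross u v = - cross v u.
Proof. by rewrite /cross; ring. Qed.

(** For nonzero [u], [v] and [z] in the upper half plane this says arg u <= arg v <= arg (z u), in a
    form linear in [u] and in [v]. *)
Definition follows z u v := 0 <= cross u v /\ 0 <= cross v (z * u).

Lemma follows_sum I (P Q : pred I) (F : I -> R[i]) z :
  (forall i j, P i -> Q j -> follows z (F i) (F j)) ->
  follows z (\sum_(i | P i) F i) (\sum_(i | Q i) F i).
Proof.
move=> PQ; split; apply: cross_suml_ge0 => i Pi.
  by apply: cross_sumr_ge0 => j Qj; case: (PQ i j).
by rewrite mulr_sumr; apply: cross_sumr_ge0 => j Pj; case: (PQ j i).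
Qed.

(** [A], [a], [B], [b], [C] stand for the blocks of a vector cut at two indices j < k: before j, at
    j, between, at k, after k. Both brackets expand into nonnegative terms. *)
Lemma follows_step z A a B b C : 0 <= complex.Im z ->
  follows z A a -> follows z A B -> follows z A b -> follows z A C ->
  follows z a B -> follows z a b -> follows z a C ->
  follows z B b -> follows z B C -> follows z b C ->
  follows z (z * A + (B + b + C)) (z * (A + a + B) + C).
Proof.
move=> z0 [Aa aA] [AB BA] [Ab bA] [AC CA] [aB Ba] [ab ba] [aC Ca]
  [Bb bB] [BC CB] [bC Cb].
have zz u := @cross_mulz_ge0 u z z0.
have nz : 0 <= complex.Re z ^+ 2 + complex.Im z ^+ 2.
  by rewrite addr_ge0 ?sqr_ge0.
split.
  (* The terms [cross (z * A) C] and [cross C (z * A)] cancel by antisymmetry. *)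
  suff -> : cross (z * A + (B + b + C)) (z * (A + a + B) + C) =
      (complex.Re z ^+ 2 + complex.Im z ^+ 2) * (cross A a + cross A B) +
      (cross B (z * A) + cross B (z * a) + cross B (z * B) + cross B C +
       cross b (z * A) + cross b (z * a) + cross b (z * B) + cross b C +
       cross C (z * a) + cross C (z * B)).
    by do ?[exact: zz | assumption | apply: addr_ge0 | apply: mulr_ge0].
  rewrite !(mulrDr z) !crossDl !crossDr !crossM crossvv.
  rewrite [cross C (z * A)]cross_anti.
  rewrite [cross C C]crossvv; ring.
(* [cross C (z * (z * A))] alone may be negative; it is absorbed in the square
   term at [z * A + C]. *)
suff -> : cross (z * (A + a + B) + C) (z * (z * A + (B + b + C))) =
    (complex.Re z ^+ 2 + complex.Im z ^+ 2) *
      (cross A B + cross A b + cross a (z * A) + cross a B + cross a b +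
       cross a C + cross B (z * A) + cross B b + cross B C) +
    (cross C (z * B) + cross C (z * b) + cross (z * A + C) (z * (z * A + C))).
  by do ?[exact: zz | assumption | apply: addr_ge0 | apply: mulr_ge0].
rewrite !(mulrDr z) !crossDl !crossDr !crossM !crossvv; ring.
Qed.

End Cross.

(** * The recurrence at a fixed point of the upper half plane *)

Section Sector.
Variables (R : rcfType) (m : nat) (z : R[i]).
Hypotheses (z_gt0 : 0 < complex.Im z) (m_gt1 : (1 < m)%N).
Implicit Types (v : 'I_m -> R[i]).

Definition sectorial v :=
  (forall i, v i != 0) /\
      forall i j : 'I_m, (i <= j)%N -> follows z (v i) (v j).

(** Pair the sum with [z * v k], where [k] is the least index in [P]: all terms are nonnegative and
    the one at [k] is positive. *)
Lemma sectorial_sum_neq0 v (P : pred 'I_m) i0 :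
  sectorial v -> P i0 -> \sum_(i | P i) v i != 0.
Proof.
move=> [v0 vv] Pi0.
case: (@arg_minnP _ i0 P (fun i => i : nat) Pi0) => k Pk kmin.
apply: contraTneq (cross_mulz_gt0 z_gt0 (v0 k)) => sum0; rewrite -leNgt.
have : cross (\sum_(i | P i) v i) (z * v k) = 0 by rewrite sum0 cross0l.
rewrite (bigD1 k) //= crossDl => /eqP; rewrite addr_eq0 => /eqP ->.
rewrite oppr_le0; apply: cross_suml_ge0 => i /andP[Pi _].
by have [] := vv _ _ (kmin _ Pi).
Qed.

Definition smirnov_step v (j : 'I_m) : R[i] :=
  z * (\sum_(i < m | (i < j)%N) v i) + \sum_(i < m | (j < i)%N) v i.

(** If z A + C = 0 with A nonzero, then <A, C> = -<A, z A> < 0, against the ordering. If A = 0, then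
    j = 0 and C is a nonempty sum because m > 1. *)
Lemma smirnov_step_neq0 v j : sectorial v -> smirnov_step v j != 0.
Proof.
move=> sv; have [v0 vv] := sv; rewrite /smirnov_step.
set A := \sum_(_ | _) _; set C := \sum_(_ | _) _.
have AC : 0 <= cross A C.
  apply: cross_suml_ge0 => a aj; apply: cross_sumr_ge0 => b jb.
  by have [] := vv a b (ltnW (ltn_trans aj jb)).
have [A0|A0] := eqVneq A 0; last first.
  apply: contraTneq AC => /eqP; rewrite addrC addr_eq0 => /eqP ->.
  by rewrite -ltNge crossNr oppr_lt0 cross_mulz_gt0.
rewrite A0 mulr0 add0r.
have [j0|j0] := posnP j; last first.
  suff /eqP : A != 0 by []; have m0 : (0 < m)%N by apply: ltn_trans m_gt1.
  by have /= := @sectorial_sum_neq0 v (fun i => i < j)%N (Ordinal m0) sv j0.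
by apply: (@sectorial_sum_neq0 v _ (Ordinal m_gt1)) => //=; rewrite j0.
Qed.

Lemma smirnov_step_split v (j k : 'I_m) : (j < k)%N ->
  let A := \sum_(i < m | (i < j)%N) v i in
  let B := \sum_(i < m | (j < i < k)%N) v i in
  let C := \sum_(i < m | (k < i)%N) v i in
  smirnov_step v j = z * A + (B + v k + C) /\
  smirnov_step v k = z * (A + v j + B) + C.
Proof.
move=> jk A B C; rewrite /smirnov_step; split; congr (_ + _).
  rewrite (bigD1 k) //= (bigID (fun i : 'I_m => i < k)%N) /=.
  rewrite addrCA addrA; congr (_ + _ + _); apply: eq_bigl => i.
    by rewrite -val_eqE /=; case: (ltngtP i k); rewrite ?andbT ?andbF.
  rewrite -val_eqE /=; case: (ltngtP i k) => ik; rewrite ?andbT ?andbF //.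
  by rewrite (ltn_trans jk ik).
congr (_ * _).
rewrite (bigD1 j) //= (bigID (fun i : 'I_m => i < j)%N) /=.
rewrite addrCA addrA; congr (_ + _ + _); apply: eq_bigl => i.
  rewrite -val_eqE /=; case: (ltngtP i j) => ij; rewrite ?andbT ?andbF //.
  by rewrite (ltn_trans ij jk).
rewrite -val_eqE /= [LHS]andbAC -[RHS]andbC.
by case: (ltngtP i j); rewrite ?andbT ?andbF.
Qed.

Lemma smirnov_stepP v : sectorial v -> sectorial (smirnov_step v).
Proof.
move=> sv; split=> [j|j k]; first exact: smirnov_step_neq0.
rewrite leq_eqVlt => /predU1P[/val_inj->|jk].
  by split; [rewrite crossvv | exact: cross_mulz_ge0 (ltW z_gt0)].
have [-> ->] := smirnov_step_split v jk.
(* Writing the two single entries as sums lets [follows_sum] treat all ten pairs of blocks alike. *)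
have -> : v j = \sum_(i | i == j) v i by rewrite big_pred1_eq.
have -> : v k = \sum_(i | i == k) v i by rewrite big_pred1_eq.
have [_ vv] := sv.
by apply: follows_step; rewrite ?(ltW z_gt0) //; apply: follows_sum => x y;
   rewrite -?val_eqE /= => xP yP; apply: vv; lia.
Qed.
End Sector.

(** * The recurrence *)

Lemma desE (w : seq nat) :
  des w = (\sum_(i < (size w).-1) (nth 0 w i.+1 < nth 0 w i))%N.
Proof. by rewrite /des cardsE -sum1_card big_mkcond. Qed.

Lemma des_rcons (x y : nat) (s : seq nat) :
  des (rcons (x :: s) y) = (des (x :: s) + (y < last x s))%N.
Proof.
rewrite !desE size_rcons big_ord_recr; congr (_ + _)%N; last first.
  by rewrite !nth_rcons ltnSn ltnn eqxx (last_nth 0%N).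
apply: eq_bigr => i _; have i_lt : (i.+1 < size (x :: s))%N := ltn_ord i.
by rewrite !nth_rcons i_lt (ltnW i_lt).
Qed.

Lemma big_tuple_rcons (A : nmodType) (T : finType) (n : nat)
    (F : n.+1.-tuple T -> A) :
  \sum_w F w = \sum_(v : n.-tuple T) \sum_(a : T) F [tuple of rcons v a].
Proof.
rewrite pair_big /=.
rewrite (reindex (fun p : n.-tuple T * T => [tuple of rcons p.1 p.2])) //.
apply/onW_bij/inj_card_bij; last by rewrite card_prod !card_tuple expnSr.
by move=> [v a] [w b] /(congr1 val) /rcons_inj [/val_inj -> ->].
Qed.

Section Recurrence.
Variables (R : realType) (m : nat).

Lemma letters_rcons r (v : r.-tuple 'I_m) (a : 'I_m) :
  letters [tuple of rcons v a] = rcons (letters v) a.+1.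
Proof. exact: map_rcons. Qed.

Lemma smirnov_rcons x s y :
  smirnov (rcons (x :: s) y) = smirnov (x :: s) && (last x s != y).
Proof. exact: rcons_path. Qed.

Lemma smirnovF1 (j : 'I_m) : smirnovF R m 1 j.+1 = 1.
Proof.
rewrite /smirnovF big_mkcond big_tuple_rcons.
rewrite (big_pred1 (nil_tuple _)) => [|v]; last exact/esym/eqP/tuple0.
(* [rev_ord j] encodes the letter m - j, which is m + 1 - (j + 1). *)
rewrite (bigD1 (rev_ord j)) //= big1 => [|a aj].
  rewrite addr0 inE letters_rcons /= addn1 subSS subnSK // eqxx.
  by rewrite desE big_ord0.
rewrite inE letters_rcons /= addn1 subSS; case: eqP => // ea.
by case/eqP: aj; apply/val_inj => /=; lia.
Qed.

Lemma last_letters r (v : r.+1.-tuple 'I_m) :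
  exists i : 'I_m, last 0%N (letters v) = (m + 1 - i.+1)%N.
Proof.
case/tupleP: v => a v; rewrite /letters /= last_map.
exists (rev_ord (last a v)) => /=; have := ltn_ord (last a v); lia.
Qed.

Lemma smirnovF_rec r (j : 'I_m) : (0 < r)%N ->
  smirnovF R m r.+1 j.+1 = 'X * (\sum_(i < m | (i < j)%N) smirnovF R m r i.+1)
                           + \sum_(i < m | (j < i)%N) smirnovF R m r i.+1.
Proof.
case: r => // r _.
(* Weight after appending the letter m - j to [v] when [v] ends in m - i: a descent for i < j, an
   ascent for i > j, a forbidden repetition for i = j. The inner sum below has exactly one index,
   that of the last letter of [v]. *)
pose H (v : r.+1.-tuple 'I_m) (i : 'I_m) : {poly R} := 'X^(des (letters v)) *
  (if (i < j)%N then 'X else if (j < i)%N then 1 else 0).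
transitivity (\sum_(v in Smir r.+1 m)
    \sum_(i < m | last 0%N (letters v) == (m + 1 - i.+1)%N) H v i).
  rewrite [LHS]big_mkcond big_tuple_rcons [RHS]big_mkcond.
  apply: eq_bigr => v _; have [i vi] := last_letters v.
  rewrite (bigD1 (rev_ord j)) //= big1 => [|a aj].
    rewrite addr0 !inE letters_rcons last_rcons /= addn1 subSS subnSK // eqxx.
    rewrite andbT (big_pred1 i) => [|k]; last first.
      rewrite /= vi -val_eqE /=; have := ltn_ord i; have := ltn_ord k; lia.
    rewrite /H.
    have: letters v != [::] by rewrite -size_eq0 size_map size_tuple.
    move: vi; case: (letters v) => // x s lasti _.
    rewrite smirnov_rcons des_rcons -[last x s]/(last 0%N (x :: s)) lasti.
    case: (smirnov (x :: s)) => //=.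
    have := ltn_ord i; have := ltn_ord j => jm im.
    case: (ltngtP i j) => ij.
    - have -> : (m + 1 - i.+1 != (m - j))%N by lia.
      have -> : ((m - j) < m + 1 - i.+1)%N by lia.
      by rewrite addn1 exprSr.
    - have -> : (m + 1 - i.+1 != (m - j))%N by lia.
      have -> : ((m - j) < m + 1 - i.+1)%N = false by lia.
      by rewrite addn0 mulr1.
    - have -> : (m + 1 - i.+1 != (m - j))%N = false by lia.
      by rewrite mulr0.
  rewrite !inE letters_rcons last_rcons /= addn1 subSS.
  rewrite [X in _ && X](_ : _ = false) ?andbF //; apply/eqP => ea.
  by case/eqP: aj; apply/val_inj => /=; lia.
under eq_bigr do rewrite big_mkcond.
rewrite exchange_big /= mulr_sumr.
rewrite [X in _ = X + _]big_mkcond [X in _ = _ + X]big_mkcond.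
rewrite -big_split /=; apply: eq_bigr => i _; rewrite /smirnovF /H.
rewrite -big_mkcondr -mulr_suml [RHS]addrC.
case: (ltngtP i j) => ij; rewrite ?addr0 ?add0r ?mulr0 ?mulr1 //.
by rewrite mulrC.
Qed.
End Recurrence.

(** * Interlacing from the upper half plane *)

Section Zeros.
Variable R : realType.
Implicit Types (p f g : {poly R}) (s t : seq R) (c x : R) (u z : R[i]).
Local Notation toC := (map_poly (real_complex R)).

(** Split over the closed field [R[i]]; the roots equal their real parts, so the factorization
    descends to [R]. *)
Lemma real_rooted_split p : real_rooted p ->
  {s : seq R | sorted (fun x y => x >= y) s &
               p = lead_coef p *: \prod_(x <- s) ('X - x%:P)}.
Proof.
move=> pR; have [r pr] := closed_field_poly_normal (toC p).
pose s := sort (fun x y => x >= y) (map (@complex.Re R) r).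
exists s; first by apply: sort_sorted => x y; apply: le_total.
apply: (map_poly_inj (real_complex R)); rewrite pr lead_coef_map map_polyZ.
congr (_ *: _); have [pz|p0] := eqVneq p 0.
  (* The zero polynomial is not real-rooted, since it vanishes at ['i]. *)
  have := pR 'i; rewrite pz map_poly0 root0 => /(_ isT)/eqP.
  by rewrite oner_eq0.
rewrite (perm_big (map (@complex.Re R) r)) /=; last by rewrite perm_sort.
rewrite big_map rmorph_prod !big_seq; apply: eq_bigr => z zr /=.
rewrite rmorphB /= map_polyX map_polyC /=; congr (_ - _%:P).
have : complex.Im z = 0.
  apply: pR; rewrite pr rootZ ?root_prod_XsubC //.
  by rewrite lead_coef_eq0 map_poly_eq0.
by case: z {zr} => a b /= ->.
Qed.

Lemma zeros_list_prod p s : p != 0 -> sorted (fun x y => x >= y) s ->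
  p = lead_coef p *: \prod_(x <- s) ('X - x%:P) -> zeros_list p s.
Proof.
move=> p0 ss pE; split=> // x; rewrite pE -mul_polyC mupMr ?mu_prod_XsubC //.
by rewrite rootC lead_coef_eq0.
Qed.

(** * Local behaviour at a real zero *)

Lemma Im_horner_real (h : {poly R[i]}) :
  exists q : {poly R}, forall x, q.[x] = complex.Im h.[x%:C].
Proof.
elim/poly_ind: h => [|h c [q qh]]; first by exists 0 => x; rewrite !horner0.
exists (q * 'X + (complex.Im c)%:P) => x; rewrite !hornerE qh.
by case: h.[_] => a b; case: c => d e /=; ring.
Qed.

Lemma horner_ge0_right p : (forall x, 0 < x -> 0 <= p.[x]) -> 0 <= p.[0].
Proof.
move=> pge0; rewrite leNgt; apply/negP => p0.
have [|d d0 dP] := @poly_cont _ 0 p (- p.[0]); first by rewrite oppr_gt0.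
have d2 : 0 < d / 2 by rewrite divr_gt0.
have := dP (d / 2); rewrite subr0 gtr0_norm // => /(_ ltac:(lra)).
have := pge0 _ d2; have := ler_norm (p.[d / 2] - p.[0]); lra.
Qed.

Lemma horner_conjc p z : (toC p).[conjc z] = conjc (toC p).[z].
Proof.
rewrite -[in RHS]horner_map -map_poly_comp; congr (_.[_]).
by apply: eq_map_poly => x /=; rewrite oppr0.
Qed.

(* Put z = c + x * u with x > 0 real, divide by x ^ (k + l), and let x -> 0. *)
Lemma cross_local f g c (k l : nat) :
  (forall z, 0 < complex.Im z ->
    0 <= cross (toC (('X - c%:P) ^+ k * f)).[z]
               (toC (('X - c%:P) ^+ l * g)).[z]) ->
  forall u, 0 < complex.Im u -> 0 <= cross (u ^+ k) (u ^+ l) * (f.[c] * g.[c]).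
Proof.
move=> fg u u0.
(* At real x, with z = c + x u, [h] takes the value conj (u^k f(z)) * u^l g(z), because f has real
   coefficients. Its imaginary part is a real polynomial in x, so the limit at 0 is plain
   continuity. *)
pose w := conjc u; pose h : {poly R[i]} := (w ^+ k * u ^+ l) *:
  (((toC f) \Po (c%:C%:P + w *: 'X)) * ((toC g) \Po (c%:C%:P + u *: 'X))).
have [q qh] := Im_horner_real h.
have crossE (a b : R[i]) : cross a b = complex.Im (conjc a * b).
  by case: a b => [a1 a2] [b1 b2]; rewrite /cross /=; ring.
have hx x : h.[x%:C] = w ^+ k * u ^+ l *
    (conjc ((toC f).[c%:C + x%:C * u]) * (toC g).[c%:C + x%:C * u]).
  rewrite /h !hornerE !horner_comp !hornerE -horner_conjc.
  rewrite rmorphD rmorphM /= oppr0.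
  by rewrite ![_ * x%:C]mulrC.
have q0 : 0 <= q.[0].
  apply: horner_ge0_right => x x0; pose z := c%:C + x%:C * u.
  have z0 : 0 < complex.Im z.
    rewrite /z; case: u u0 {w h qh hx z} => a b /= b0.
    by rewrite mul0r addr0 add0r mulr_gt0.
  have shiftE n p : (toC (('X - c%:P) ^+ n * p)).[z] =
      (x ^+ n)%:C * (u ^+ n * (toC p).[z]).
    rewrite rmorphM rmorphXn rmorphB /= map_polyX map_polyC /= hornerM.
    rewrite horner_exp !hornerE /z [_ + _ * u]addrC addrK exprMn rmorphXn.
    by [].
  have := fg z z0; rewrite !shiftE crossE qh hx -/z.
  have -> : conjc ((x ^+ k)%:C * (u ^+ k * (toC f).[z])) *
      ((x ^+ l)%:C * (u ^+ l * (toC g).[z])) =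
      (x ^+ (k + l))%:C * (w ^+ k * u ^+ l * (conjc (toC f).[z] * (toC g).[z])).
    have -> v : conjc ((x ^+ k)%:C * v) = (x ^+ k)%:C * conjc v.
      by case: v => a b /=; congr Complex; ring.
    have -> v : conjc (u ^+ k * v) = w ^+ k * conjc v.
      by rewrite rmorphM rmorphXn.
    rewrite exprD (rmorphM (real_complex R)); ring.
  have ImZ (r : R) (v : R[i]) : complex.Im (r%:C * v) = r * complex.Im v.
    by case: v => a b /=; ring.
  by rewrite ImZ pmulr_rge0 ?mulr_gt0 ?exprn_gt0.
move: q0; rewrite qh hx mul0r addr0 !horner_map /= crossE rmorphXn oppr0 -/w.
by case: (w ^+ k * u ^+ l) => a b /=; congr (_ <= _); ring.
Qed.

(** The principal root lies in the closed upper half plane, and it is not real because [w] is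
    not. *)
Lemma exists_upper_root (n : nat) (w : R[i]) : (1 < n)%N -> complex.Im w != 0 ->
  exists2 u, 0 < complex.Im u & u ^+ n = w.
Proof.
move=> n1 w0; pose u := n.-root w.
have un : u ^+ n = w by rewrite rootCK // ltnW.
exists u => //; rewrite lt_def; apply/andP; split.
  apply: contra w0 => /eqP u0; rewrite -un.
  have -> : u = (complex.Re u)%:C by case: u u0 {un} => a b /= ->.
  by rewrite -rmorphXn.
have := Im_rootC_ge0 w n1; by rewrite -/u -complexIm ler0c.
Qed.

Lemma cross_exp u (k d : nat) : cross (u ^+ k) (u ^+ (k + d)) =
  (complex.Re (u ^+ k) ^+ 2 + complex.Im (u ^+ k) ^+ 2) * complex.Im (u ^+ d).
Proof.
by rewrite exprD -[X in cross X _]mulr1 crossM /cross /= mul1r mul0r subr0.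
Qed.

(** Up to the positive factor |u^k|^2 the bracket is Im (u^d). For d = 1 take u = i; for d >= 2
    choose u with u^d = -a i, which gives the value -a^2 < 0. *)
Lemma Im_exp_sign (k d : nat) (a : R) : a != 0 ->
  (forall u, 0 < complex.Im u -> 0 <= cross (u ^+ k) (u ^+ (k + d)) * a) ->
  d = 0%N \/ d = 1%N /\ 0 < a.
Proof.
move=> a0 ua.
have {}ua u : 0 < complex.Im u -> 0 <= complex.Im (u ^+ d) * a.
  move=> u0; have := ua u u0; rewrite cross_exp -mulrA pmulr_rge0 //.
  rewrite lt_def addr_ge0 ?sqr_ge0 // andbT paddr_eq0 ?sqr_ge0 // !sqrf_eq0.
  rewrite -[_ && _]/((_ == complex.Re 0) && (_ == complex.Im 0)) -eq_complex.
  rewrite expf_eq0 negb_and; apply/orP; right.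
  by apply: contraTneq u0 => ->; rewrite ltxx.
case: d ua => [|[|d]] ua; [by left | right | exfalso].
  by have /= := ua 'i; rewrite ltr01 mul1r lt_def a0; auto.
have [||u u0 uE] := @exists_upper_root d.+2 (Complex 0 (- a)) => //=.
  by rewrite oppr_eq0.
have := ua u u0; rewrite uE /= mulNr oppr_ge0 leNgt -expr2.
by rewrite lt_def sqrf_eq0 a0 sqr_ge0.
Qed.

(** * Counting zeros above a real point *)

Lemma sign_prod c s :
  0 < (-1) ^+ count (fun y => c < y) s * \prod_(y <- s | y != c) (c - y).
Proof.
elim: s => [|y s IHs]; first by rewrite big_nil mulr1 ltr01.
rewrite big_cons /=; case: (ltgtP c y) => cy /=; last by [].
  rewrite add1n exprS mulN1r mulNr mulrCA -mulNr opprB pmulr_rgt0 //.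
  by rewrite subr_gt0.
by rewrite add0n mulrCA pmulr_rgt0 // subr_gt0.
Qed.

Lemma prod_XsubC_count c s : \prod_(y <- s) ('X - y%:P) =
  ('X - c%:P) ^+ count_mem c s * \prod_(y <- s | y != c) ('X - y%:P).
Proof.
rewrite (bigID (pred1 c)) /=; congr (_ * _).
elim: s => [|y s IHs]; rewrite ?big_nil ?big_cons //=.
by case: eqP => [->|_]; rewrite ?exprS IHs.
Qed.

(** [c] need not belong to [s], so that one [c] serves the zeros of both polynomials. *)
Lemma count_gt_step x c s : x < c ->
  (forall y, y \in s -> x < y -> c <= y) ->
  count (fun y => x < y) s = (count (fun y => (c < y)%R) s + count_mem c s)%N.
Proof.
move=> xc; elim: s => //= y s IHs ys; rewrite IHs; last first.
  by move=> z zs; apply: ys; rewrite in_cons zs orbT.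
rewrite addnACA; congr (_ + _)%N; have := ys y; rewrite mem_head.
case: (ltgtP c y) => [cy|yc|<-] => [_|/(_ isT)|_].
- by rewrite (lt_trans xc).
- by case: ltP => // _ /(_ isT).
- by rewrite xc.
Qed.

Lemma next_element x s : has (fun y => x < y) s ->
  exists c, [/\ c \in s, x < c & forall y, y \in s -> x < y -> c <= y].
Proof.
elim: s => //= y s IHs xs.
have [/IHs[c [cs xc cmin]]|/hasPn sx] := boolP (has (fun y => x < y) s);
  last first.
  have xy : x < y by case/orP: xs => // /hasP[z /sx /negbTE ->].
  exists y; split=> // [|z]; first exact: mem_head.
  by rewrite in_cons => /predU1P[-> //|/sx /negbTE ->].
have [[xy yc]|yc] : (x < y /\ y <= c) \/ (x < y -> c <= y).
  by case: (ltP x y) (leP y c) => xy [yc|cy]; auto; right=> // _; apply: ltW.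
  exists y; split=> // [|z]; first exact: mem_head.
  rewrite in_cons => /predU1P[-> //|zs xz]; exact: le_trans yc (cmin _ zs xz).
exists c; split=> // [|z]; first by rewrite in_cons cs orbT.
by rewrite in_cons => /predU1P[->|]; [apply: yc | apply: cmin].
Qed.

Lemma horner_prod_XsubC c s : (\prod_(y <- s | y != c) ('X - y%:P)).[c] =
  \prod_(y <- s | y != c) (c - y).
Proof. by rewrite horner_prod; apply: eq_bigr => y _; rewrite hornerXsubC. Qed.

(** Induction on the number of zeros of f and g above x: the claim at x follows from the claim at
    the nearest zero c > x. *)
Lemma count_interlace f g s t :
  0 < lead_coef f -> 0 < lead_coef g ->
  f = lead_coef f *: \prod_(y <- s) ('X - y%:P) ->
  g = lead_coef g *: \prod_(y <- t) ('X - y%:P) ->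
  (forall z, 0 < complex.Im z -> 0 <= cross (toC f).[z] (toC g).[z]) ->
  forall x, let n r := count (fun y => x < y) r in
    n t = n s \/ n t = (n s).+1.
Proof.
move=> f0 g0 fE gE fg x.
have [n] :=
  ubnP (count (fun y => (x < y)%R) s + count (fun y => (x < y)%R) t)%N.
elim: n x => // n IHn x; rewrite ltnS => xn N.
have [xz|xpos] := posnP (count (fun y => x < y) (s ++ t)).
  move: xz; rewrite count_cat => /eqP; rewrite addn_eq0.
  by move=> /andP[/eqP ns /eqP nt]; left; rewrite /N ns nt.
have [c [cst xc cmin]] : exists c, [/\ c \in s ++ t, x < c &
    forall y, y \in s ++ t -> x < y -> c <= y].
  by apply: next_element; rewrite has_count.
have NsE : N s = (count (fun y => (c < y)%R) s + count_mem c s)%N.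
  by apply: count_gt_step => // y ys; apply: cmin; rewrite mem_cat ys.
have NtE : N t = (count (fun y => (c < y)%R) t + count_mem c t)%N.
  by apply: count_gt_step => // y yt; apply: cmin; rewrite mem_cat yt orbT.
have kl : (0 < count_mem c s + count_mem c t)%N.
  by rewrite -count_cat -has_count has_pred1.
have /IHn /= : (count (fun y => (c < y)%R) s +
                count (fun y => (c < y)%R) t < n)%N.
  by move: xn; rewrite -/(N s) -/(N t) NsE NtE; lia.
rewrite NsE NtE; move: (sign_prod c s) (sign_prod c t).
set k := count_mem c s in kl NsE *; set l := count_mem c t in kl NtE *.
set ns := count _ s; set nt := count _ t => sgs sgt nst.
(* [F] and [G] are the cofactors of (X - c)^k in f and (X - c)^l in g, nonzero at c. *)
pose F := lead_coef f *: \prod_(y <- s | y != c) ('X - y%:P).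
pose G := lead_coef g *: \prod_(y <- t | y != c) ('X - y%:P).
have := @cross_local F G c k l.
rewrite -!scalerAr -!prod_XsubC_count -fE -gE => /(_ fg).
have : 0 < (-1) ^+ ns * F.[c].
  by rewrite hornerZ horner_prod_XsubC mulrCA pmulr_rgt0.
have : 0 < (-1) ^+ nt * G.[c].
  by rewrite hornerZ horner_prod_XsubC mulrCA pmulr_rgt0.
move: F.[c] G.[c] => a b b0 a0 ab.
have sgK : 0 < (-1) ^+ (ns + nt) * (a * b).
  by rewrite exprD mulrACA mulr_gt0.
have K0 : a * b != 0 by apply: contraTneq sgK => ->; rewrite mulr0 ltxx.
(* The sign of F(c) G(c) tells whether the difference of the counts above c is 0 or 1. *)
have {}sgK : (nt = ns /\ 0 < a * b) \/ (nt = ns.+1 /\ 0 < - (a * b)).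
  case: nst => e; [left|right]; split=> //; move: sgK; rewrite e.
    by rewrite addnn -mul2n exprM sqrrN !expr1n mul1r.
  by rewrite addnS addnn -mul2n exprS exprM sqrrN !expr1n mulr1 mulN1r.
(* For k <= l the difference grows by at most 1, and not at all if it is already 1, as then a b <
   0. *)
have [lk|/ltnW lk] := leqP k l.
  have := @Im_exp_sign k (l - k) (a * b) K0; rewrite subnKC // => /(_ ab) lkd.
  have e1 : (l - k = 0 \/ l - k = 1)%N by case: lkd => [|[]]; auto.
  case: sgK => -[ntE sg]; rewrite ntE; first by lia.
  have e2 : (l - k = 0)%N.
    case: lkd => [|[_ sg']] //; move: sg; rewrite oppr_gt0 => sg.
    by have := lt_trans sg sg'; rewrite ltxx.
  lia.
(* For l < k exchange the two arguments; antisymmetry flips the sign, so the difference can drop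
   only from 1 to 0. *)
have := @Im_exp_sign l (k - l) (- (a * b)).
rewrite oppr_eq0 subnKC // => /(_ K0) lkd.
have {}lkd : (k - l = 0)%N \/ (k - l = 1)%N /\ 0 < - (a * b).
  apply: lkd => u u0; rewrite cross_anti mulrNN; exact: ab.
have e1 : (k - l = 0 \/ k - l = 1)%N by case: lkd => [|[]]; auto.
case: sgK => -[ntE sg]; rewrite ntE; last by lia.
have e2 : (k - l = 0)%N.
  case: lkd => [|[_]] //; rewrite oppr_gt0 => sg'.
  by have := lt_trans sg sg'; rewrite ltxx.
lia.
Qed.

(** In a decreasing list the entries above [x] form an initial segment; this turns counts into
    inequalities between zeros of given rank. *)
Lemma sorted_count_gt (x : R) s i : sorted (fun x y => x >= y) s ->
  (i < count (fun y => x < y)%R s)%N = (i < size s)%N && (x < s`_i).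
Proof.
elim: s i => [|y s IHs] i ys; first by rewrite ltn0.
have [xy|yx] := ltP x y.
  rewrite /= xy; case: i => [|i] //=.
  by rewrite add1n !ltnS IHs // (path_sorted ys).
have sx : all (fun w => w <= x) (y :: s).
  rewrite /= yx; apply: (sub_all _ (order_path_min _ ys)) => [w wy|a b c ba ac].
    exact: le_trans yx.
  exact: le_trans ac ba.
have -> : count (fun y => x < y) (y :: s) = 0%N.
  apply/eqP; rewrite -leqn0 leqNgt -has_count; apply/hasPn => w ws.
  by rewrite -leNgt (allP sx).
rewrite ltn0; apply/esym/negbTE; rewrite negb_and -leNgt -implybE.
by apply/implyP => i_lt; rewrite (allP sx) ?mem_nth.
Qed.

Lemma cross_interlaces f g : 0 < lead_coef f -> 0 < lead_coef g ->
  real_rooted f -> real_rooted g ->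
  (forall z, 0 < complex.Im z -> 0 <= cross (toC f).[z] (toC g).[z]) ->
  interlaces f g.
Proof.
move=> f0 g0 fR gR fg; split=> //.
have [s ss fE] := real_rooted_split fR; have [t ts gE] := real_rooted_split gR.
have nst := count_interlace f0 g0 fE gE fg.
exists s, t; split.
- by apply: zeros_list_prod; rewrite // -lead_coef_eq0 gt_eqF.
- by apply: zeros_list_prod; rewrite // -lead_coef_eq0 gt_eqF.
(* [x] lies below all zeros, so both counts are full sizes; the 0 in the minimum covers the empty
   list. *)
- pose r := s ++ t; pose x := \big[Num.min/0]_(y <- r) y - 1.
  have xr y : y \in r -> x < y.
    move=> yr; rewrite ltrBlDr
      (le_lt_trans (ge_bigmin_seq 0 y xpredT id yr isT)) //.
    by rewrite ltrDl.
  have size_count q : {subset q <= r} -> count (fun y => x < y) q = size q.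
    by move=> qr; apply/eqP; rewrite -all_count; apply/allP => y /qr /xr.
  have := nst x; rewrite /= !size_count // => y yr; rewrite mem_cat yr ?orbT //.
(* If beta_i < alpha_i, then above beta_i there are more zeros of f than of g. *)
- move=> i si; rewrite leNgt; apply/negP => ti.
  have := nst t`_i; rewrite /=; have := sorted_count_gt t`_i i ss.
  have := sorted_count_gt t`_i i ts; rewrite si ti ltxx andbF /=.
  by set a := count _ t; set b := count _ s; lia.
(* If alpha_i < beta_(i+1), then above alpha_i g has at least two more zeros than f. *)
- move=> i si it; rewrite leNgt; apply/negP => ti.
  have := nst s`_i; rewrite /=; have := sorted_count_gt s`_i i ss.
  have := sorted_count_gt s`_i i.+1 ts; rewrite it ti ltxx andbF /=.
  by set a := count _ t; set b := count _ s; lia.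
Qed.

(** Nonreal zeros of a real polynomial come in conjugate pairs. *)
Lemma upper_nonvanishing_real_rooted p :
  (forall z, 0 < complex.Im z -> (toC p).[z] != 0) -> real_rooted p.
Proof.
move=> pz z; case: (ltgtP (complex.Im z) 0) => // z0 /eqP pz0.
  have := pz (conjc z); rewrite horner_conjc pz0 conjc0 eqxx => /(_ _)/negP[] //.
  by case: z z0 {pz0} => a b /=; rewrite oppr_gt0.
by have := pz z z0; rewrite pz0 eqxx.
Qed.

End Zeros.

(** * Application to the Smirnov polynomials *)

Section SmirnovPolynomials.
Variables (R : realType) (m : nat).
Local Notation toC := (map_poly (real_complex R)).

Lemma sum_smirnovF r : (0 < r)%N ->
  \sum_(w in Smir r m) 'X^(des (letters w)) =
  \sum_(i < m) smirnovF R m r i.+1.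
Proof.
case: r => // r _; rewrite /smirnovF.
under [RHS]eq_bigr do rewrite big_mkcondr.
rewrite exchange_big; apply: eq_bigr => w _ /=; have [i wi] := last_letters w.
rewrite -big_mkcond (big_pred1 i) // => k; rewrite /= wi -val_eqE /=.
have := ltn_ord i; have := ltn_ord k; lia.
Qed.

Lemma coef_smirnovF_ge0 r j k : 0 <= (smirnovF R m r j)`_k.
Proof. by rewrite coef_sum sumr_ge0 // => w _; rewrite coefXn ler0n. Qed.

(** Induction on the length: for one letter all values are 1, and the recurrence preserves sectorial
    vectors. *)
Lemma smirnovF_sectorial r (z : R[i]) :
  (0 < r)%N -> (1 < m)%N -> 0 < complex.Im z ->
  sectorial z (fun j : 'I_m => (toC (smirnovF R m r j.+1)).[z]).
Proof.
move=> r0 m1 z0; case: r r0 => // r _; elim: r => [|r IHr].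
  split=> [i|i j _]; rewrite !smirnovF1 rmorph1 hornerE ?oner_eq0 //.
  by split; [rewrite crossvv | apply/cross_mulz_ge0/ltW].
have [v0 vv] := smirnov_stepP z0 m1 IHr.
have stepE (j : 'I_m) : (toC (smirnovF R m r.+2 j.+1)).[z] =
    smirnov_step z (fun j : 'I_m => (toC (smirnovF R m r.+1 j.+1)).[z]) j.
  rewrite smirnovF_rec // rmorphD rmorphM /= map_polyX !rmorph_sum /=.
  by rewrite !hornerE !horner_sum.
by split=> [i|i j ij]; rewrite !stepE; [apply: v0 | apply: vv].
Qed.

End SmirnovPolynomials.

Theorem theorem4p2 (R : realType) (r m : nat) (hr : (1 <= r)%N)
    (hm : (2 <= m)%N) :
  interlacing_seq (fun j : 'I_m => smirnovF R m r j.+1) /\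
  real_rooted (\sum_(w in Smir r m) 'X^(des (letters w)) : {poly R}).
Proof.
have sect z := @smirnovF_sectorial R m r z hr hm.
split=> [i j ij|].
  have rooted (k : 'I_m) : real_rooted (smirnovF R m r k.+1).
    by apply: upper_nonvanishing_real_rooted => z /sect[v0 _]; apply: v0 k.
  have lead (k : 'I_m) : 0 < lead_coef (smirnovF R m r k.+1).
    (* The coefficients are nonnegative, and the value at ['i] is nonzero. *)
    rewrite lt_def coef_smirnovF_ge0 andbT lead_coef_eq0.
    have [|v0 _] := sect 'i; first exact: ltr01.
    by apply: contraNneq (v0 k) => ->; rewrite map_poly0 horner0.
  by apply: cross_interlaces => // z /sect[_ vv]; case: (vv i j (ltnW ij)).
apply: upper_nonvanishing_real_rooted => z z0.
rewrite sum_smirnovF // rmorph_sum horner_sum.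
exact: (sectorial_sum_neq0 z0 (i0 := Ordinal hm) (sect z z0)).
Qed.
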